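(* Let $q\ge0$ be arbitrary. Suppose there exists $\mathsf{K}=\begin{bmatrix}D_{\mathsf K}&C_{\mathsf K}\\ B_{\mathsf K}&A_{\mathsf K}\end{bmatrix}\in\mathcal{C}_q$ such that $0\in\partial J_{\infty,q}(\mathsf K)$. Then for any $q'\ge1$ and any stable $\Lambda\in\mathbb{R}^{q'\times q'}$, the policy $$\tilde{\mathsf K}=\begin{bmatrix}D_{\mathsf K}&C_{\mathsf K}&0\\ B_{\mathsf K}&A_{\mathsf K}&0\\ 0&0&\Lambda\end{bmatrix}\in\mathcal{C}_{q+q'}$$ (of order $q+q'$, with $A_{\tilde{\mathsf K}}=\begin{bmatrix}A_{\mathsf K}&0\\ 0&\Lambda\end{bmatrix}$, $B_{\tilde{\mathsf K}}=\begin{bmatrix}B_{\mathsf K}\\ 0\end{bmatrix}$, $C_{\tilde{\mathsf K}}=\begin{bmatrix}C_{\mathsf K}&0\end{bmatrix}$, $D_{\tilde{\mathsf K}}=D_{\mathsf K}$) is a Clarke stationary point of $J_{\infty,q+q'}$ over $\mathcal{C}_{q+q'}$, i.e., $0\in\partial J_{\infty,q+q'}(\tilde{\mathsf K})$, and it satisfies $J_{\infty,q+q'}(\tilde{\mathsf K})=J_{\infty,q}(\mathsf K)$.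
   Context: Plant data: integers $n,m,p\ge 1$, real matrices $A\in\mathbb{R}^{n\times n}$, $B\in\mathbb{R}^{n\times m}$, $C\in\mathbb{R}^{p\times n}$, and symmetric weights $Q\succeq 0$, $W\succeq 0$ ($n\times n$), $R\succ 0$ ($m\times m$), $V\succ 0$ ($p\times p$); $M^{1/2}$ is the symmetric positive semidefinite square root. Standing assumptions: $(A,B)$ and $(A,W^{1/2})$ are controllable, $(C,A)$ and $(Q^{1/2},A)$ are observable. A square matrix is stable if all its eigenvalues have strictly negative real parts. A dynamic policy of order $q\ge0$ is a matrix $\mathsf{K}=\begin{bmatrix}D_{\mathsf K} & C_{\mathsf K}\\ B_{\mathsf K} & A_{\mathsf K}\end{bmatrix}\in\mathbb{R}^{(m+q)\times(p+q)}$ with $A_{\mathsf K}\in\mathbb{R}^{q\times q}$, $B_{\mathsf K}\in\mathbb{R}^{q\times p}$, $C_{\mathsf K}\in\mathbb{R}^{m\times q}$, $D_{\mathsf K}\in\mathbb{R}^{m\times p}$. Define $$A_{\mathrm{cl}}(\mathsf K)=\begin{bmatrix}A+BD_{\mathsf K}C & BC_{\mathsf K}\\ B_{\mathsf K}C & A_{\mathsf K}\end{bmatrix},\quad B_{\mathrm{cl}}(\mathsf K)=\begin{bmatrix}W^{1/2}&BD_{\mathsf K}V^{1/2}\\ 0&B_{\mathsf K}V^{1/2}\end{bmatrix},$$ $$C_{\mathrm{cl}}(\mathsf K)=\begin{bmatrix}Q^{1/2}&0\\ R^{1/2}D_{\mathsf K}C&R^{1/2}C_{\mathsf K}\end{bmatrix},\quad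 D_{\mathrm{cl}}(\mathsf K)=\begin{bmatrix}0&0\\ 0&R^{1/2}D_{\mathsf K}V^{1/2}\end{bmatrix}.$$ $\mathcal{C}_q=\{\mathsf K\in\mathbb{R}^{(m+q)\times(p+q)}: A_{\mathrm{cl}}(\mathsf K)\text{ is stable}\}$, an open set. The $\mathcal{H}_\infty$ cost is $J_{\infty,q}(\mathsf K)=\sup_{\omega\in\mathbb{R}}\sigma_{\max}\big(C_{\mathrm{cl}}(\mathsf K)(j\omega I-A_{\mathrm{cl}}(\mathsf K))^{-1}B_{\mathrm{cl}}(\mathsf K)+D_{\mathrm{cl}}(\mathsf K)\big)$ for $\mathsf K\in\mathcal{C}_q$, with $\sigma_{\max}$ the largest singular value. This function is locally Lipschitz on $\mathcal{C}_q$. For a locally Lipschitz $f$ on an open subset of a Euclidean space (here matrices with the trace inner product), the Clarke directional derivative is $f^\circ(x;v)=\limsup_{x'\to x,\,t\downarrow0}\frac{f(x'+tv)-f(x')}{t}$ and the Clarke subdifferential is $\partial f(x)=\{g: f^\circ(x;v)\ge\langle g,v\rangle\ \forall v\}$. *)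

(* Defs.v *)
From HB Require Import structures.
From mathcomp Require Import all_boot all_order all_algebra.
From mathcomp Require Import complex.
From mathcomp Require Import all_classical all_reals all_analysis.

Set Implicit Arguments.
Unset Strict Implicit.
Unset Printing Implicit Defensive.

Import Order.TTheory GRing.Theory Num.Theory.
Import numFieldNormedType.Exports.

Local Open Scope classical_set_scope.
Local Open Scope ring_scope.
Local Open Scope complex_scope.
Local Open Scope sesquilinear_scope.

Section MatrixNotions.
Variable R : realType.

Definition psdmx n (M : 'M[R]_n) : Prop :=
  M^T = M /\ forall x : 'cV[R]_n, 0 <= (x^T *m M *m x) 0 0.

Definition pdmx n (M : 'M[R]_n) : Prop :=
  M^T = M /\ forall x : 'cV[R]_n, x != 0 -> 0 < (x^T *m M *m x) 0 0.

(* The default value 0 is only reached when M is not positive semidefinite. *)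
Definition sqrtmx n (M : 'M[R]_n) : 'M[R]_n :=
  xget 0 [set S | psdmx S /\ S *m S = M].

Definition cmx a b (M : 'M[R]_(a, b)) : 'M[R[i]]_(a, b) :=
  map_mx (real_complex R) M.

Definition stable n (M : 'M[R]_n) : Prop :=
  forall z : R[i], eigenvalue (cmx M) z -> complex.Re z < 0.

(* Full row rank of [B, AB, ..., A^(n-1)B]. *)
Definition controllable n m (A : 'M[R]_n) (B : 'M[R]_(n, m)) : Prop :=
  \rank (\mxrow_(i < n) (A ^+ i *m B)) = n.

(* Full column rank of the stack of C, CA, ..., CA^(n-1). *)
Definition observable n p (C : 'M[R]_(p, n)) (A : 'M[R]_n) : Prop :=
  \rank (\mxcol_(i < n) (C *m A ^+ i)) = n.

(* For b > 0 the set is finite and nonempty, so that sup is its maximum.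
   Taking the Gram matrix of size b only affects the multiplicity of 0 among
   the singular values. *)
Definition sigma_max a b (M : 'M[R[i]]_(a, b)) : R :=
  sup [set s : R | 0 <= s /\ eigenvalue (M ^t* *m M) (s ^+ 2)%:C].

End MatrixNotions.

Section Clarke.
Variables (R : realType) (a b : nat).
Implicit Types (f : 'M[R]_(a, b) -> R) (x v g : 'M[R]_(a, b)).

Definition trace_dot g v : R := \tr (g^T *m v).

(* This only depends on f near x, so that it also applies to a function that is
   meaningful only on an open set containing x. *)
Definition clarke_dd f x v : \bar R :=
  limf_esup
    (fun xt : 'M[R]_(a, b) * R => ((f (xt.1 + xt.2 *: v) - f xt.1) / xt.2)%:E)
    (filter_prod (nbhs x) (0 : R)^'+).

Definition clarke_subdiff f x : set 'M[R]_(a, b) :=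
  [set g | forall v, ((trace_dot g v)%:E <= clarke_dd f x v)%E].

End Clarke.

Record plant (R : realType) (n m p : nat) := Plant {
  plA : 'M[R]_n;
  plB : 'M[R]_(n, m);
  plC : 'M[R]_(p, n);
  plQ : 'M[R]_n;
  plW : 'M[R]_n;
  plR : 'M[R]_m;
  plV : 'M[R]_p }.

Section ClosedLoop.
Variables (R : realType) (n m p : nat) (P : plant R n m p).

Local Notation A := (plA P).
Local Notation B := (plB P).
Local Notation C := (plC P).
Local Notation Qh := (sqrtmx (plQ P)).
Local Notation Wh := (sqrtmx (plW P)).
Local Notation Rh := (sqrtmx (plR P)).
Local Notation Vh := (sqrtmx (plV P)).

Section Order.
Variable q : nat.
Implicit Type K : 'M[R]_(m + q, p + q).

Definition polD K : 'M[R]_(m, p) := ulsubmx K.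
Definition polC K : 'M[R]_(m, q) := ursubmx K.
Definition polB K : 'M[R]_(q, p) := dlsubmx K.
Definition polA K : 'M[R]_q := drsubmx K.

Definition Acl K : 'M[R]_(n + q) :=
  block_mx (A + B *m polD K *m C) (B *m polC K) (polB K *m C) (polA K).

Definition Bcl K : 'M[R]_(n + q, n + p) :=
  block_mx Wh (B *m polD K *m Vh) 0 (polB K *m Vh).

Definition Ccl K : 'M[R]_(n + m, n + q) :=
  block_mx Qh 0 (Rh *m polD K *m C) (Rh *m polC K).

Definition Dcl K : 'M[R]_(n + m, n + p) :=
  block_mx 0 0 0 (Rh *m polD K *m Vh).

Definition stabilizing : set 'M[R]_(m + q, p + q) :=
  [set K | stable (Acl K)].

(* invmx is a genuine inverse here as soon as K is stabilizing. *)
Definition transfer K (w : R) : 'M[R[i]]_(n + m, n + p) :=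
  cmx (Ccl K) *m invmx ((0 +i* w)%:M - cmx (Acl K)) *m cmx (Bcl K)
  + cmx (Dcl K).

(* For stabilizing K the set is bounded and sup is the least upper bound;
   elsewhere the value is irrelevant. *)
Definition Jinf K : R := sup (range (fun w : R => sigma_max (transfer K w))).

End Order.
End ClosedLoop.

Arguments stabilizing {R n m p} P q K.
Arguments Jinf {R n m p} P q K.

Definition augment (R : realType) (m p q q' : nat)
    (K : 'M[R]_(m + q, p + q)) (L : 'M[R]_q') :
    'M[R]_(m + (q + q'), p + (q + q')) :=
  block_mx (polD K) (row_mx (polC K) 0)
           (col_mx (polB K) 0) (block_mx (polA K) 0 0 L).

(* Main.v *)
Require Import Defs.
From mathcomp Require Import all_boot all_order all_algebra.
From mathcomp Require Import complex.
From mathcomp Require Import all_classical all_reals all_analysis.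
From mathcomp Require Import ring lra.

(** The extra subsystem of the augmented policy is decoupled from the loop, so
    the policy stabilizes and has the same transfer function, hence the same
    cost, as [K]. Stationarity is not a consequence of this alone, because the
    directions [v] available in the larger policy space may couple the extra
    states to the loop. The point is that coupling is a second-order effect. If
    [K'] is close to [K] and [t] is small, the policy [augment K' L + t *: v]
    is the policy [K' + t *: core v] of order [q] with an extra subsystem
    that is entered with a gain of order [t] and left with a gain of order
    [t]. Eliminating the extra states shows that the two transfer functions
    differ by a product in which both gains occur ([transfer_core_diff]).

    All the other factors are uniformly bounded in the frequency and near the
    augmented policy ([transfer_core_gap]), because the resolvent of a stable
    matrix is bounded on the closed right half-plane, uniformly near that
    matrix ([stable_resolvent_bounded], [stable_resolvent_near]). As
    [sigma_max] is 1-Lipschitz ([sigma_max_lipschitz]), the two costs differ by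
    at most [b * t ^+ 2] for some constant [b].

    Hence a difference quotient of the cost at [augment K' L] in the direction
    [v] is at least the difference quotient of the cost of order [q] at [K'] in
    the direction [core v], minus [b * t]. The upper limit of the latter as
    [K'] tends to [K] and [t] to 0 is nonnegative by stationarity of [K], and
    base points of the form [augment K' L] are admissible in the Clarke
    directional derivative at [augment K L] ([clarke_zero_transport]). *)

Set Implicit Arguments.
Unset Strict Implicit.
Unset Printing Implicit Defensive.

Import Order.TTheory GRing.Theory Num.Theory.
Import numFieldNormedType.Exports.

Local Open Scope classical_set_scope.
Local Open Scope ring_scope.
Local Open Scope complex_scope.
Local Open Scope sesquilinear_scope.

(** * Real matrices seen as complex matrices *)

Section Complexification.
Variable R : realType.

Lemma cmxD a b (M N : 'M[R]_(a, b)) : cmx (M + N) = cmx M + cmx N.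
Proof. exact: map_mxD. Qed.

Lemma cmxB a b (M N : 'M[R]_(a, b)) : cmx (M - N) = cmx M - cmx N.
Proof. exact: map_mxB. Qed.

Lemma cmxM a b c (M : 'M[R]_(a, b)) (N : 'M[R]_(b, c)) :
  cmx (M *m N) = cmx M *m cmx N.
Proof. exact: map_mxM. Qed.

Lemma cmx_block a1 a2 b1 b2 (M1 : 'M[R]_(a1, b1)) (M2 : 'M[R]_(a1, b2))
    (M3 : 'M[R]_(a2, b1)) (M4 : 'M[R]_(a2, b2)) :
  cmx (block_mx M1 M2 M3 M4) = block_mx (cmx M1) (cmx M2) (cmx M3) (cmx M4).
Proof. exact: map_block_mx. Qed.

Lemma cmx_row a b1 b2 (M1 : 'M[R]_(a, b1)) (M2 : 'M[R]_(a, b2)) :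
  cmx (row_mx M1 M2) = row_mx (cmx M1) (cmx M2).
Proof. exact: map_row_mx. Qed.

Lemma cmx_col a1 a2 b (M1 : 'M[R]_(a1, b)) (M2 : 'M[R]_(a2, b)) :
  cmx (col_mx M1 M2) = col_mx (cmx M1) (cmx M2).
Proof. exact: map_col_mx. Qed.

End Complexification.

(** * The entrywise sum norm *)

Section SumNorm.
Variable R : realType.
Implicit Types (a b c : nat) (z : R[i]).

Lemma normc_ge0 z : 0 <= Normc.normc z.
Proof. by case: z => x y; exact: sqrtr_ge0. Qed.

Lemma normc_sum (I : Type) (r : seq I) (F : I -> R[i]) :
  Normc.normc (\sum_(i <- r) F i) <= \sum_(i <- r) Normc.normc (F i).
Proof.
elim/big_ind2: _ => [|x1 x2 y1 y2 h1 h2|//]; first by rewrite Normc.normc0.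
by apply: le_trans (le_normcD _ _) (lerD _ _).
Qed.

(** All error estimates are made in this norm: it is submultiplicative,
    dominates the operator norm, and is additive on blocks. *)
Definition sumnorm a b (M : 'M[R[i]]_(a, b)) : R :=
  \sum_i \sum_j Normc.normc (M i j).

Lemma sumnorm_ge0 a b (M : 'M[R[i]]_(a, b)) : 0 <= sumnorm M.
Proof. by do 2!apply: sumr_ge0 => ? _; exact: normc_ge0. Qed.

Lemma sumnorm0 a b : sumnorm (0 : 'M[R[i]]_(a, b)) = 0.
Proof. by do 2!apply: big1 => ? _; rewrite mxE Normc.normc0. Qed.

Lemma sumnorm_eq0 a b (M : 'M[R[i]]_(a, b)) : sumnorm M <= 0 -> M = 0.
Proof.
move=> M0; apply/matrixP => i j; rewrite mxE; apply: Normc.eq0_normc.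
have /eqP/psumr_eq0P h : sumnorm M == 0 by rewrite eq_le M0 sumnorm_ge0.
have /psumr_eq0P -> // :=
  h (fun i _ => sumr_ge0 _ (fun j _ => normc_ge0 _)) i isT.
by move=> k _; exact: normc_ge0.
Qed.

Lemma sumnormN a b (M : 'M[R[i]]_(a, b)) : sumnorm (- M) = sumnorm M.
Proof. by do 2!apply: eq_bigr => ? _; rewrite mxE normcN. Qed.

Lemma sumnormD a b (M N : 'M[R[i]]_(a, b)) :
  sumnorm (M + N) <= sumnorm M + sumnorm N.
Proof.
rewrite -big_split; apply: ler_sum => i _; rewrite -big_split.
by apply: ler_sum => j _; rewrite mxE; exact: le_normcD.
Qed.

Lemma sumnormZ a b z (M : 'M[R[i]]_(a, b)) :
  sumnorm (z *: M) = Normc.normc z * sumnorm M.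
Proof.
rewrite mulr_sumr; apply: eq_bigr => i _; rewrite mulr_sumr.
by apply: eq_bigr => j _; rewrite mxE Normc.normcM.
Qed.

Lemma sumnormM a b c (M : 'M[R[i]]_(a, b)) (N : 'M[R[i]]_(b, c)) :
  sumnorm (M *m N) <= sumnorm M * sumnorm N.
Proof.
rewrite mulr_suml; apply: ler_sum => i _; rewrite mulr_suml.
apply: (@le_trans _ _
  (\sum_j \sum_k Normc.normc (M i k) * Normc.normc (N k j))).
  apply: ler_sum => j _; rewrite mxE; apply: le_trans (normc_sum _ _) _.
  by apply: ler_sum => k _; rewrite Normc.normcM.
rewrite exchange_big; apply: ler_sum => k _.
rewrite -mulr_sumr ler_wpM2l ?normc_ge0 //.
rewrite [leRHS](bigD1 k) //= lerDl; apply: sumr_ge0 => ? _.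
by apply: sumr_ge0 => ? _; exact: normc_ge0.
Qed.

Lemma sumnorm_trC a b (M : 'M[R[i]]_(a, b)) : sumnorm (M^t*) = sumnorm M.
Proof.
rewrite /sumnorm exchange_big; apply: eq_bigr => i _; apply: eq_bigr => j _.
by rewrite !mxE; apply: complexI; exact: norm_conjC.
Qed.

Lemma sumnorm_mul_le a b c (M : 'M[R[i]]_(a, b)) (N : 'M[R[i]]_(b, c)) x y :
  sumnorm M <= x -> sumnorm N <= y -> sumnorm (M *m N) <= x * y.
Proof.
move=> Mx Ny; apply: le_trans (sumnormM _ _) _.
by apply: ler_pM; rewrite ?sumnorm_ge0.
Qed.

Lemma sumnorm_col a1 a2 b (M : 'M[R[i]]_(a1, b)) (N : 'M[R[i]]_(a2, b)) :
  sumnorm (col_mx M N) = sumnorm M + sumnorm N.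
Proof.
rewrite /sumnorm big_split_ord; congr (_ + _); do 2!apply: eq_bigr => ? _.
  by rewrite col_mxEu.
by rewrite col_mxEd.
Qed.

Lemma sumnorm_row a b1 b2 (M : 'M[R[i]]_(a, b1)) (N : 'M[R[i]]_(a, b2)) :
  sumnorm (row_mx M N) = sumnorm M + sumnorm N.
Proof.
rewrite /sumnorm -big_split; apply: eq_bigr => i _; rewrite big_split_ord.
by congr (_ + _); apply: eq_bigr => ? _; rewrite (row_mxEl, row_mxEr).
Qed.

End SumNorm.

(** * The largest singular value is 1-Lipschitz *)

Lemma dotmx_triangle (C : numClosedFieldType) n (u v : 'rV[C]_n) :
  sqrtC (dotmx (u + v) (u + v)) <= sqrtC (dotmx u u) + sqrtC (dotmx v v).
Proof. exact: (triangle_lerif (@dotmx C n) u v).1. Qed.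

Lemma dotmx_scale (C : numClosedFieldType) n z (v : 'rV[C]_n) :
  dotmx (z *: v) (z *: v) = `|z| ^+ 2 * dotmx v v.
Proof. exact: dnormZ. Qed.

Section SigmaMax.
Variable R : realType.
Implicit Types (a b n : nat).

Definition l2norm n (v : 'rV[R[i]]_n) : R := complex.Re (sqrtC (dotmx v v)).

Lemma l2normE n (v : 'rV[R[i]]_n) : (l2norm v)%:C = sqrtC (dotmx v v).
Proof.
have : 0 <= sqrtC (dotmx v v) by rewrite sqrtC_ge0 (dnorm_ge0 (@dotmx _ n)).
rewrite /l2norm; case: (sqrtC _) => x y; rewrite lecE /= => /andP[/eqP -> _] //.
Qed.

Lemma l2norm_sqr n (v : 'rV[R[i]]_n) : (l2norm v)%:C ^+ 2 = dotmx v v.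
Proof. by rewrite l2normE sqrtCK. Qed.

Lemma l2norm_ge0 n (v : 'rV[R[i]]_n) : 0 <= l2norm v.
Proof. by rewrite -lecR l2normE sqrtC_ge0 (dnorm_ge0 (@dotmx _ n)). Qed.

Lemma l2norm_gt0 n (v : 'rV[R[i]]_n) : v != 0 -> 0 < l2norm v.
Proof. by rewrite -ltcR l2normE sqrtC_gt0 (dnorm_gt0 (@dotmx _ n)). Qed.

Lemma l2normD n (u v : 'rV[R[i]]_n) : l2norm (u + v) <= l2norm u + l2norm v.
Proof.
rewrite -lecR rmorphD /= [X in X <= _]l2normE.
rewrite [X in _ <= X + _]l2normE [X in _ <= _ + X]l2normE.
exact: dotmx_triangle.
Qed.

Lemma l2normZ n z (v : 'rV[R[i]]_n) :
  l2norm (z *: v) = Normc.normc z * l2norm v.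
Proof.
apply: complexI; rewrite rmorphM /= [LHS]l2normE [X in _ = _ * X]l2normE.
by rewrite dotmx_scale rootCMl ?exprn_ge0 // sqrCK.
Qed.

Lemma normc_le_l2norm n (v : 'rV[R[i]]_n) i : Normc.normc (v 0 i) <= l2norm v.
Proof.
rewrite -(@ler_pXn2r _ 2) ?nnegrE ?normc_ge0 ?l2norm_ge0 //.
rewrite -lecR !rmorphXn /= l2norm_sqr dotmxE mxE (bigD1 i) //= !mxE.
rewrite -normCK lerDl; apply: sumr_ge0 => j _.
by rewrite !mxE -normCK exprn_ge0.
Qed.

(** Expand [M] over the matrix units [delta_mx i j]: each of them extracts one
    entry of [v], which is bounded by the norm of [v]. *)
Lemma l2norm_mul_le a b (v : 'rV[R[i]]_a) (M : 'M[R[i]]_(a, b)) :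
  l2norm (v *m M) <= sumnorm M * l2norm v.
Proof.
have l2sum (I : Type) (r : seq I) (F : I -> 'rV[R[i]]_b) :
    l2norm (\sum_(i <- r) F i) <= \sum_(i <- r) l2norm (F i).
  elim/big_ind2: _ => [|x1 x2 y1 y2 h1 h2|//].
    by rewrite -lecR l2normE (linear0l (@dotmx _ b)) rootC0.
  by apply: le_trans (l2normD _ _) (lerD _ _).
rewrite {1}[M]matrix_sum_delta mulmx_sumr mulr_suml.
apply: le_trans (l2sum _ _ _) _; apply: ler_sum => i _.
rewrite mulmx_sumr mulr_suml.
apply: le_trans (l2sum _ _ _) _; apply: ler_sum => j _.
rewrite -scalemxAr l2normZ ler_wpM2l ?normc_ge0 //.
have -> : v *m delta_mx i j = v 0 i *: delta_mx 0 j.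
  apply/rowP => k; rewrite !mxE (bigD1 i) //= big1 => [|l /negPf il].
    by rewrite !mxE !eqxx addr0.
  by rewrite !mxE il mulr0.
rewrite l2normZ; suff -> : l2norm (delta_mx 0 j : 'rV[R[i]]_b) = 1.
  by rewrite mulr1 normc_le_l2norm.
apply: complexI; rewrite l2normE dotmxE -rowE !mxE !eqxx conjC1.
exact: sqrtC1.
Qed.

Lemma gram_eigen_l2norm a b (M : 'M[R[i]]_(a, b)) s (v : 'rV[R[i]]_b) :
  0 <= s -> v *m (M^t* *m M) = (s ^+ 2)%:C *: v ->
  l2norm (v *m M^t*) = s * l2norm v.
Proof.
move=> s0 vM.
have: (l2norm (v *m M^t*))%:C ^+ 2 = (s * l2norm v)%:C ^+ 2.
  rewrite rmorphM /= exprMn !l2norm_sqr !dotmxE trmx_mul map_mxM /= trmxCK.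
  by rewrite mulmxA -(mulmxA v) vM -scalemxAl mxE rmorphXn.
rewrite -!rmorphXn => /complexI/eqP; rewrite eqrXn2 ?mulr_ge0 ?l2norm_ge0 //.
by move/eqP.
Qed.

Lemma singular_values_bounded a b (M : 'M[R[i]]_(a, b)) :
  ubound [set s : R | 0 <= s /\ eigenvalue (M^t* *m M) (s ^+ 2)%:C] (sumnorm M).
Proof.
move=> s [s0 /eigenvalueP[v vM v0]].
rewrite -(ler_pM2r (l2norm_gt0 v0)) -(gram_eigen_l2norm s0 vM) -(sumnorm_trC M).
exact: l2norm_mul_le.
Qed.

Lemma sigma_max_ge0 a b (M : 'M[R[i]]_(a, b)) : 0 <= sigma_max M.
Proof.
rewrite /sigma_max; set S := [set _ | _].
have [[[s Ss] ubS]|/sup_out -> //] := pselect (has_sup S).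
by apply: le_trans (ub_le_sup ubS Ss); case: Ss.
Qed.

(** The spectral theorem applied to the Gram matrix; an eigenvalue is the
    square of the length of the image of a unit eigenvector, hence the square
    of a nonnegative real. *)
Lemma spectral_gram a b (M : 'M[R[i]]_(a, b)) :
  exists U : 'M[R[i]]_b, exists d : 'I_b -> R,
  [/\ U \is unitarymx, M^t* *m M = U^t* *m diag_mx (\row_i (d i ^+ 2)%:C) *m U &
   forall i, 0 <= d i /\ eigenvalue (M^t* *m M) (d i ^+ 2)%:C].
Proof.
set G := M^t* *m M.
have Gn : G \is normalmx.
  by apply/normalmxP; rewrite /G !trmx_mul !map_mxM /= !trmxCK.
have /orthomx_spectralP := Gn; set U := spectralmx G; set D := spectral_diag G.
have Uu : U \is unitarymx := spectral_unitarymx _.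
rewrite invmx_unitary // => GE.
have UG i : row i U *m G = D 0 i *: row i U.
  rewrite [in LHS]GE !mulmxA -row_mul (unitarymxP Uu) row1 -rowE.
  by rewrite row_diag_mx -scalemxAl -rowE.
have Ui1 i : dotmx (row i U) (row i U) = 1.
  by have /row_unitarymxP/(_ i i) := Uu; rewrite eqxx.
have DE i : D 0 i = (l2norm (row i U *m M^t*))%:C ^+ 2.
  rewrite l2norm_sqr dotmxE trmx_mul map_mxM /= trmxCK mulmxA.
  by rewrite -(mulmxA (row _ _)) UG -scalemxAl mxE -dotmxE Ui1 mulr1.
exists U, (fun i => l2norm (row i U *m M^t*)); split=> //.
  rewrite GE; congr (_ *m diag_mx _ *m _); apply/rowP => i.
  by rewrite mxE DE rmorphXn.
move=> i; split; first exact: l2norm_ge0.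
apply/eigenvalueP; exists (row i U); first by rewrite rmorphXn /= -DE UG.
apply/eqP => U0; have /eqP := Ui1 i.
by rewrite U0 dotmxE mul0mx mxE eq_sym oner_eq0.
Qed.

(** [sigma_max] is the operator norm: in an orthonormal eigenbasis of the Gram
    matrix the quadratic form is a combination of squared singular values. *)
Lemma l2norm_le_sigma_max a b (M : 'M[R[i]]_(a, b)) (v : 'rV[R[i]]_b) :
  l2norm (v *m M^t*) <= sigma_max M * l2norm v.
Proof.
have [U [d [Uu GE dP]]] := spectral_gram M.
rewrite -(@ler_pXn2r _ 2) ?nnegrE ?mulr_ge0 ?l2norm_ge0 ?sigma_max_ge0 //.
rewrite -lecR !rmorphXn /= rmorphM exprMn !l2norm_sqr !dotmxE.
rewrite trmx_mul map_mxM /= trmxCK mulmxA -(mulmxA v) GE.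
set w := v *m U^t*.
have -> : v *m v^t* = w *m w^t*.
  rewrite /w trmx_mul map_mxM /= trmxCK mulmxA -(mulmxA v).
  by rewrite mulmx1C ?mulmx1 //; apply/unitarymxP.
have -> : v *m (U^t* *m diag_mx (\row_i (d i ^+ 2)%:C) *m U) *m v^t* =
          w *m diag_mx (\row_i (d i ^+ 2)%:C) *m w^t*.
  by rewrite /w [(_ *m _)^T]trmx_mul map_mxM /= trmxCK !mulmxA.
rewrite mul_mx_diag !mxE mulr_sumr; apply: ler_sum => i _.
rewrite !mxE mulrAC -normCK mulrC ler_wpM2r ?exprn_ge0 //.
have [d0 de] := dP i.
rewrite -rmorphXn /= lecR ler_sqr ?nnegrE ?sigma_max_ge0 //.
by apply: ub_le_sup; [exists (sumnorm M); exact: singular_values_bounded|split].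
Qed.

(** A singular vector of [M] is a competitor in the operator norm of [N]. *)
Lemma sigma_max_lipschitz a b (M N : 'M[R[i]]_(a, b)) : (0 < b)%N ->
  sigma_max M <= sigma_max N + sumnorm (M - N).
Proof.
move=> b0; apply: ge_sup.
  have [U [d [_ _ dP]]] := spectral_gram M.
  by exists (d (Ordinal b0)); exact: dP.
move=> s [s0 /eigenvalueP[v vM v0]].
rewrite -(ler_pM2r (l2norm_gt0 v0)) -(gram_eigen_l2norm s0 vM) mulrDl.
have -> : v *m M^t* = v *m N^t* + v *m (M - N)^t*.
  by rewrite -mulmxDr -map_mxD -linearD /= addrC subrK.
apply: le_trans (l2normD _ _) _; rewrite lerD ?l2norm_le_sigma_max //.
by rewrite -(sumnorm_trC (M - N)); exact: l2norm_mul_le.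
Qed.

End SigmaMax.

(** * Resolvents of stable matrices on the closed right half-plane *)

Section Resolvent.
Variable R : realType.
Implicit Types (n k : nat) (z : R[i]).

Lemma unitmx_of_left_injective (F : fieldType) N (M : 'M[F]_N) :
  (forall v : 'rV[F]_N, v *m M = 0 -> v = 0) -> M \in unitmx.
Proof.
move=> inj; rewrite -row_free_unit -kermx_eq0; apply/eqP/row_matrixP => i.
by rewrite row0; apply: inj; rewrite -row_mul mulmx_ker row0.
Qed.

Lemma unitmx_of_right_injective (F : fieldType) N (M : 'M[F]_N) :
  (forall X : 'M[F]_N, M *m X = 0 -> X = 0) -> M \in unitmx.
Proof.
move=> inj; rewrite -row_full_unit -cokermx_eq0; apply/eqP/inj.
exact: mulmx_coker.
Qed.

Lemma stable_unitmx n (M : 'M[R]_n) z :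
  stable M -> 0 <= complex.Re z -> z%:M - cmx M \in unitmx.
Proof.
move=> Ms z0; apply: unitmx_of_left_injective => v.
rewrite mulmxBr mul_mx_scalar => /eqP; rewrite subr_eq0 => /eqP vM.
apply/eqP; apply: contraT => v0; suff: complex.Re z < 0 by rewrite ltNge z0.
by apply: Ms; apply/eigenvalueP; exists v.
Qed.

Lemma stable_of_unitmx N (M : 'M[R]_N) :
  (forall z, 0 <= complex.Re z -> z%:M - cmx M \in unitmx) -> stable M.
Proof.
move=> Mu z /eigenvalueP[v vM v0]; rewrite ltNge; apply: contra v0 => /Mu zM.
by rewrite -(mulmxK zM v) mulmxBr mul_mx_scalar vM subrr mul0mx.
Qed.

Lemma normc_ge_Re_dist z l :
  complex.Re l < 0 -> 0 <= complex.Re z ->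
  - complex.Re l <= Normc.normc (z - l).
Proof.
case: z l => a b [c d] /= c0 a0; apply: (@le_trans _ _ `|a - c|).
  by rewrite (le_trans _ (ler_norm _)) // lerDr.
by rewrite -sqrtr_sqr ler_wsqrtr // lerDl sqr_ge0.
Qed.

(** Removing the roots one at a time bounds the resolvent without compactness.
    If [Y] solves [(z - A) Y = X], then [(A - l) Y] solves the same equation
    with right-hand side [(A - l) X], and
    [(z - l) Y = X + (A - l) Y] with [|z - l| >= - Re l > 0]. When the list of
    roots is exhausted the right-hand side is 0, and so is the solution. *)
Lemma eliminated_solution_bounded n k (A : 'M[R[i]]_n) (s : seq R[i])
    (X : 'M[R[i]]_(n, k)) :
  {in s, forall l, complex.Re l < 0} ->
  foldl (fun X l => (A - l%:M) *m X) X s = 0 ->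
  exists2 c : R, 0 <= c & forall z (Y : 'M[R[i]]_(n, k)), 0 <= complex.Re z ->
    z%:M - A \in unitmx -> (z%:M - A) *m Y = X -> sumnorm Y <= c.
Proof.
elim: s X => [|l s IH] X s0 /=.
  move=> X0; exists 0 => // z Y z0 zA; rewrite X0 => Y0.
  by rewrite -(mulKmx zA Y) Y0 mulmx0 sumnorm0.
move=> /IH[l' /(mem_behead (s := l :: s))/s0 //|c c0 cP].
have l0 : complex.Re l < 0 by apply: s0; rewrite mem_head.
exists ((sumnorm X + c) / - complex.Re l).
  by rewrite divr_ge0 ?addr_ge0 ?sumnorm_ge0 // oppr_ge0 ltW.
move=> z Y z0 zA zY.
have Y'c : sumnorm ((A - l%:M) *m Y) <= c.
  apply: (cP z) => //; rewrite -zY !mulmxA; congr (_ *m _).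
  rewrite [LHS]mulmxBl [RHS]mulmxBr !mulmxBr !mulmxBl.
  by rewrite -!(scalar_mxC l) -!(scalar_mxC z) -scalar_mxM mulrC scalar_mxM.
rewrite ler_pdivlMr ?oppr_gt0 // mulrC.
apply: le_trans (ler_wpM2r (sumnorm_ge0 Y) (normc_ge_Re_dist l0 z0)) _.
rewrite -sumnormZ.
have -> : (z - l) *: Y = X + (A - l%:M) *m Y.
  by rewrite -zY -mulmxDl addrA subrK -raddfB mul_scalar_mx.
by apply: le_trans (sumnormD _ _) _; rewrite lerD2l.
Qed.

Lemma foldl_horner_mx n k (A : 'M[R[i]]_n.+1) (s : seq R[i])
    (X : 'M[R[i]]_(n.+1, k)) :
  foldl (fun X l => (A - l%:M) *m X) X s =
  horner_mx A (\prod_(l <- s) ('X - l%:P)) *m X.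
Proof.
elim: s X => [|l s IH] X /=; first by rewrite big_nil rmorph1 mul1mx.
rewrite IH big_cons mulrC rmorphM /= -mulmxE -mulmxA; congr (_ *m (_ *m _)).
by rewrite rmorphB /= horner_mx_X horner_mx_C.
Qed.

(** By Cayley-Hamilton the elimination along the roots of the characteristic
    polynomial ends with 0. *)
Lemma stable_resolvent_bounded n (A : 'M[R]_n) : stable A ->
  exists2 c : R, 0 <= c & forall z, 0 <= complex.Re z ->
    sumnorm (invmx (z%:M - cmx A)) <= c.
Proof.
case: n A => [|n] A As.
  exists 0 => // z _; rewrite [invmx _](_ : _ = 0) ?sumnorm0 //.
  by apply/matrixP => -[].
have [s sP] := closed_field_poly_normal (char_poly (cmx A)).
rewrite (monicP (char_poly_monic _)) scale1r in sP.
have s0 : {in s, forall l, complex.Re l < 0}.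
  by move=> l ls; apply: As; rewrite eigenvalue_root_char sP root_prod_XsubC.
have [] := @eliminated_solution_bounded _ _ (cmx A) s 1%:M s0.
  by rewrite foldl_horner_mx -sP Cayley_Hamilton mul0mx.
move=> c c0 cP; exists c => // z z0; apply: (cP z) => //.
  exact: stable_unitmx.
by rewrite mulmxV // stable_unitmx.
Qed.

(** A perturbation [E] of [A] with [d * c <= 1/2], where [c] bounds the
    resolvent [X] of [A], is absorbed in [Y = X + X E Y]. *)
Lemma stable_resolvent_near n (A : 'M[R]_n) : stable A ->
  exists c d : R, [/\ 0 <= c, 0 < d & forall (M : 'M[R]_n) z,
    sumnorm (cmx (M - A)) <= d -> 0 <= complex.Re z ->
    z%:M - cmx M \in unitmx /\ sumnorm (invmx (z%:M - cmx M)) <= c].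
Proof.
move=> As; have [c c0 cP] := stable_resolvent_bounded As.
exists (2 * c), (2 * c + 1)^-1; split; first by rewrite mulr_ge0.
  by rewrite invr_gt0 ltr_wpDl ?mulr_ge0.
move=> M z; set d := _^-1 => MA z0.
have d0 : 0 < 2 * c + 1 by rewrite ltr_wpDl ?mulr_ge0.
have dc : d * c <= 2^-1.
  by rewrite /d mulrC ler_pdivrMr //; lra.
have zA := stable_unitmx As z0; have {cP} := cP z z0.
set X := invmx _ => Xc.
have E : z%:M - cmx A = z%:M - cmx M + cmx (M - A).
  by rewrite cmxB addrA subrK.
have zM : z%:M - cmx M \in unitmx.
  apply: unitmx_of_left_injective => v vM; apply: sumnorm_eq0.
  have vE : v = v *m (cmx (M - A) *m X).
    by rewrite mulmxA; apply: (canRL (mulmxK zA)); rewrite E mulmxDr vM add0r.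
  have : sumnorm v <= sumnorm v * (d * c).
    by rewrite {1}vE; apply: sumnorm_mul_le => //; exact: sumnorm_mul_le.
  have := ler_wpM2l (sumnorm_ge0 v) dc; lra.
split=> //; set Y := invmx _.
have YE : Y = X + X *m (cmx (M - A) *m Y).
  by rewrite -[in LHS](mulKmx zA Y) -/X E mulmxDl (mulmxV zM) mulmxDr mulmx1.
have : sumnorm Y <= c + c * (d * sumnorm Y).
  rewrite {1}YE; apply: le_trans (sumnormD _ _) (lerD _ _) => //.
  by do 2!apply: sumnorm_mul_le => //.
have := ler_wpM2r (sumnorm_ge0 Y) dc; rewrite mulrA (mulrC c); lra.
Qed.

End Resolvent.

(** * The closed loop as an affine function of the policy *)

Section Affine.
Variables (R : realType) (n m p : nat) (P : plant R n m p).

Local Notation A := (plA P).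
Local Notation B := (plB P).
Local Notation C := (plC P).
Local Notation Qh := (sqrtmx (plQ P)).
Local Notation Wh := (sqrtmx (plW P)).
Local Notation Rh := (sqrtmx (plR P)).
Local Notation Vh := (sqrtmx (plV P)).

Variable q : nat.
Implicit Type K : 'M[R]_(m + q, p + q).

(** Absorbing the policy states into the plant turns a dynamic policy into a
    static one: the policy matrix [K] acts between the following constant
    matrices. *)
Definition actuation : 'M[R]_(n + q, m + q) := block_mx B 0 0 1%:M.
Definition sensing : 'M[R]_(p + q, n + q) := block_mx C 0 0 1%:M.
Definition sensor_noise : 'M[R]_(p + q, n + p) := block_mx 0 Vh 0 0.
Definition control_cost : 'M[R]_(n + m, m + q) := block_mx 0 0 Rh 0.

Lemma AclE K : Acl P K = block_mx A 0 0 0 + actuation *m K *m sensing.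
Proof.
rewrite -[in RHS](submxK K) /actuation /sensing !mulmx_block add_block_mx.
by rewrite !(mul0mx, mul1mx, mulmx0, mulmx1, addr0, add0r).
Qed.

Lemma BclE K : Bcl P K = block_mx Wh 0 0 0 + actuation *m K *m sensor_noise.
Proof.
rewrite -[in RHS](submxK K) /actuation /sensor_noise !mulmx_block add_block_mx.
by rewrite !(mul0mx, mul1mx, mulmx0, mulmx1, addr0, add0r).
Qed.

Lemma CclE K : Ccl P K = block_mx Qh 0 0 0 + control_cost *m K *m sensing.
Proof.
rewrite -[in RHS](submxK K) /control_cost /sensing !mulmx_block add_block_mx.
by rewrite !(mul0mx, mul1mx, mulmx0, mulmx1, addr0, add0r).
Qed.

Lemma affine_dist a b (c : 'M[R]_(a, b)) (F : 'M[R]_(a, m + q))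
    (G : 'M[R]_(p + q, b)) K K' :
  sumnorm (cmx ((c + F *m K' *m G) - (c + F *m K *m G))) <=
  sumnorm (cmx F) * sumnorm (cmx (K' - K)) * sumnorm (cmx G).
Proof.
rewrite opprD addrACA subrr add0r -mulmxBl -mulmxBr !cmxM.
exact: sumnorm_mul_le (sumnormM _ _) _.
Qed.

Lemma affine_bounded_near a b (c : 'M[R]_(a, b)) (F : 'M[R]_(a, m + q))
    (G : 'M[R]_(p + q, b)) K K' : sumnorm (cmx (K' - K)) <= 1 ->
  sumnorm (cmx (c + F *m K' *m G)) <=
  sumnorm (cmx (c + F *m K *m G)) + sumnorm (cmx F) * sumnorm (cmx G).
Proof.
move=> KK'; rewrite -[c + F *m K' *m G](subrK (c + F *m K *m G)).
rewrite [cmx (_ - _ + _)]cmxD [leRHS]addrC.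
apply: le_trans (sumnormD _ _) _; rewrite lerD2r.
apply: le_trans (affine_dist _ _ _ _ _) _.
by rewrite ler_wpM2r ?sumnorm_ge0 // ler_piMr // sumnorm_ge0.
Qed.

Lemma closed_loop_resolvent_near K : stabilizing P q K ->
  exists c d : R, [/\ 0 <= c, 0 < d & forall K' (w : R),
    sumnorm (cmx (K' - K)) <= d ->
    (0 +i* w)%:M - cmx (Acl P K') \in unitmx /\
    sumnorm (invmx ((0 +i* w)%:M - cmx (Acl P K'))) <= c].
Proof.
move=> /stable_resolvent_near[c [d [c0 d0 cdP]]].
set f := sumnorm (cmx actuation); set g := sumnorm (cmx sensing).
have fg : 0 < f * g + 1 by rewrite ltr_wpDl ?mulr_ge0 ?sumnorm_ge0.
exists c, (d / (f * g + 1)); split=> //; first by rewrite divr_gt0.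
move=> K' w KK'; apply: cdP => //.
rewrite !AclE; apply: le_trans (affine_dist _ _ _ _ _) _.
rewrite -/f -/g mulrAC; rewrite ler_pdivlMr // in KK'.
apply: le_trans KK'; rewrite mulrC ler_wpM2l ?sumnorm_ge0 //.
by rewrite lerDl.
Qed.

End Affine.

(** * Policies of order q + q' as perturbations of policies of order q *)

Section Split.
Variables (R : realType) (n m p : nat) (P : plant R n m p).
Variables (q q' : nat).
Implicit Types (x y : 'M[R]_(m + (q + q'), p + (q + q'))).
Implicit Types (K : 'M[R]_(m + q, p + q)) (L : 'M[R]_q').

Local Notation F := (actuation P q).
Local Notation G := (sensing P q).
Local Notation H := (sensor_noise P q).
Local Notation E := (control_cost P q).

(** A policy of order [q + q'] is a policy of order [q], its core, coupled
    through [extra_out] and [extra_in] to a subsystem with [q'] states and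
    dynamics [extra_dyn]. *)
Definition core x : 'M[R]_(m + q, p + q) :=
  block_mx (polD x) (lsubmx (polC x)) (usubmx (polB x)) (ulsubmx (polA x)).

Definition extra_out x : 'M[R]_(m + q, q') :=
  col_mx (rsubmx (polC x)) (ursubmx (polA x)).

Definition extra_in x : 'M[R]_(q', p + q) :=
  row_mx (dsubmx (polB x)) (dlsubmx (polA x)).

Definition extra_dyn x : 'M[R]_q' := drsubmx (polA x).

(** The states [n + (q + q')] of the closed loop are regrouped as
    [(n + q) + q']. *)
Definition core_state k (X : 'M[R[i]]_(n + (q + q'), k))
    : 'M[R[i]]_(n + q, k) :=
  col_mx (usubmx X) (usubmx (dsubmx X)).

Definition extra_state k (X : 'M[R[i]]_(n + (q + q'), k))
    : 'M[R[i]]_(q', k) := dsubmx (dsubmx X).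

Lemma core_line x y t : core (x + t *: y) = core x + t *: core y.
Proof.
rewrite /core scale_block_mx add_block_mx /polD /polC /polB /polA.
rewrite /ulsubmx /ursubmx /dlsubmx /drsubmx.
by rewrite !linearD !linearZ.
Qed.

Lemma extra_out_line x y t :
  extra_out (x + t *: y) = extra_out x + t *: extra_out y.
Proof.
rewrite /extra_out scale_col_mx add_col_mx /polC /polA /ursubmx /drsubmx.
by rewrite !linearD !linearZ.
Qed.

Lemma extra_in_line x y t :
  extra_in (x + t *: y) = extra_in x + t *: extra_in y.
Proof.
rewrite /extra_in scale_row_mx add_row_mx /polB /polA /dlsubmx /drsubmx.
by rewrite !linearD !linearZ.
Qed.

Lemma extra_dyn_line x y t :
  extra_dyn (x + t *: y) = extra_dyn x + t *: extra_dyn y.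
Proof. by rewrite /extra_dyn /polA /drsubmx !linearD !linearZ. Qed.

Lemma core_augment K L : core (augment K L) = K.
Proof.
rewrite /core /augment /polD /polC /polB /polA.
rewrite block_mxKul block_mxKur block_mxKdl block_mxKdr block_mxKul.
by rewrite row_mxKl col_mxKu submxK.
Qed.

Lemma extra_out_augment K L : extra_out (augment K L) = 0.
Proof.
rewrite /extra_out /augment /polC /polA.
by rewrite block_mxKur block_mxKdr block_mxKur row_mxKr col_mx0.
Qed.

Lemma extra_in_augment K L : extra_in (augment K L) = 0.
Proof.
rewrite /extra_in /augment /polB /polA.
by rewrite block_mxKdl block_mxKdr block_mxKdl col_mxKd row_mx0.
Qed.

Lemma extra_dyn_augment K L : extra_dyn (augment K L) = L.
Proof. by rewrite /extra_dyn /augment /polA block_mxKdr block_mxKdr. Qed.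

Lemma sumnorm_core x : sumnorm (cmx (core x)) <= sumnorm (cmx x).
Proof.
have [D [c1 [c2 [b1 [b2 [a1 [a2 [a3 [a4 ->]]]]]]]]] :
    exists D c1 c2 b1 b2 a1 a2 a3 a4,
    x = block_mx D (row_mx c1 c2) (col_mx b1 b2) (block_mx a1 a2 a3 a4).
  do 9 eexists.
  by rewrite -{1}(submxK x) -{1}(hsubmxK (ursubmx x))
    -{1}(vsubmxK (dlsubmx x)) -{1}(submxK (drsubmx x)).
rewrite /core /polD /polC /polB /polA.
rewrite block_mxKul block_mxKur block_mxKdl block_mxKdr block_mxKul.
rewrite row_mxKl col_mxKu /block_mx.
rewrite !(cmx_col, cmx_row, sumnorm_col, sumnorm_row).
have := (sumnorm_ge0 (cmx c2), sumnorm_ge0 (cmx b2), sumnorm_ge0 (cmx a2),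
  sumnorm_ge0 (cmx a3), sumnorm_ge0 (cmx a4)).
case=> -[[[h1 h2] h3] h4] h5; lra.
Qed.

Lemma sumnorm_drsub a1 a2 b1 b2 (M : 'M[R]_(a1 + a2, b1 + b2)) :
  sumnorm (cmx (drsubmx M)) <= sumnorm (cmx M).
Proof.
rewrite -[in leRHS](submxK M) /block_mx !(cmx_col, cmx_row).
rewrite !(sumnorm_col, sumnorm_row).
by rewrite addrA lerDr !addr_ge0 ?sumnorm_ge0.
Qed.

Lemma sumnorm_extra_dyn x : sumnorm (cmx (extra_dyn x)) <= sumnorm (cmx x).
Proof. exact: le_trans (sumnorm_drsub _) (sumnorm_drsub _). Qed.

Lemma sumnorm_core_state k (X : 'M[R[i]]_(n + (q + q'), k)) :
  sumnorm (core_state X) <= sumnorm X.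
Proof.
rewrite /core_state -[in leRHS](vsubmxK X) -[in leRHS](vsubmxK (dsubmx X)).
by rewrite !sumnorm_col addrA lerDl sumnorm_ge0.
Qed.

Lemma Acl_blocks x : Acl P x =
  block_mx (plA P + plB P *m polD x *m plC P)
    (row_mx (plB P *m lsubmx (polC x)) (plB P *m rsubmx (polC x)))
    (col_mx (usubmx (polB x) *m plC P) (dsubmx (polB x) *m plC P))
    (block_mx (ulsubmx (polA x)) (ursubmx (polA x))
              (dlsubmx (polA x)) (drsubmx (polA x))).
Proof. by rewrite submxK -mul_mx_row hsubmxK -mul_col_mx vsubmxK. Qed.

Lemma Acl_core x : Acl P (core x) =
  block_mx (plA P + plB P *m polD x *m plC P) (plB P *m lsubmx (polC x))
    (usubmx (polB x) *m plC P) (ulsubmx (polA x)).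
Proof.
rewrite /Acl /polD /polC /polB /polA /core.
by rewrite block_mxKul block_mxKur block_mxKdl block_mxKdr.
Qed.

Lemma actuation_extra_out x :
  F *m extra_out x = col_mx (plB P *m rsubmx (polC x)) (ursubmx (polA x)).
Proof. by rewrite mul_block_col !mul0mx mul1mx add0r addr0. Qed.

Lemma extra_in_sensing x :
  extra_in x *m G = row_mx (dsubmx (polB x) *m plC P) (dlsubmx (polA x)).
Proof. by rewrite mul_row_block !mulmx0 mulmx1 add0r addr0. Qed.

Lemma core_state_Acl k x (X : 'M[R[i]]_(n + (q + q'), k)) :
  core_state (cmx (Acl P x) *m X) =
  cmx (Acl P (core x)) *m core_state X
  + cmx (F *m extra_out x) *m extra_state X.
Proof.
rewrite Acl_blocks Acl_core actuation_extra_out /core_state /extra_state.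
rewrite -(vsubmxK X); move: (usubmx X) (dsubmx X) => X1 {}X.
rewrite -(vsubmxK X); move: (usubmx X) (dsubmx X) => X2 X3.
rewrite !(cmx_block, cmx_row, cmx_col) !col_mxKd !col_mxKu.
rewrite !mul_block_col mul_row_col mul_col_mx !(col_mxKu, col_mxKd).
by rewrite add_col_mx col_mxKu mul_col_mx add_col_mx !addrA.
Qed.

Lemma extra_state_Acl k x (X : 'M[R[i]]_(n + (q + q'), k)) :
  extra_state (cmx (Acl P x) *m X) =
  cmx (extra_in x *m G) *m core_state X + cmx (extra_dyn x) *m extra_state X.
Proof.
rewrite Acl_blocks extra_in_sensing /core_state /extra_state.
rewrite -(vsubmxK X); move: (usubmx X) (dsubmx X) => X1 {}X.
rewrite -(vsubmxK X); move: (usubmx X) (dsubmx X) => X2 X3.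
rewrite !(cmx_block, cmx_row, cmx_col) !col_mxKd !col_mxKu.
rewrite !mul_block_col mul_row_col mul_col_mx !(col_mxKu, col_mxKd).
by rewrite add_col_mx col_mxKd mul_row_col addrA.
Qed.

Lemma Bcl_blocks x : Bcl P x =
  col_mx (row_mx (sqrtmx (plW P)) (plB P *m polD x *m sqrtmx (plV P)))
    (block_mx 0 (usubmx (polB x) *m sqrtmx (plV P))
              0 (dsubmx (polB x) *m sqrtmx (plV P))).
Proof. by rewrite block_mxEh col_mx0 -mul_col_mx vsubmxK. Qed.

Lemma core_state_Bcl x : core_state (cmx (Bcl P x)) = cmx (Bcl P (core x)).
Proof.
rewrite Bcl_blocks /core_state /Bcl /polD /polB /core block_mxKul block_mxKdl.
by rewrite /block_mx !cmx_col !col_mxKu col_mxKd col_mxKu.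
Qed.

Lemma extra_state_Bcl x : extra_state (cmx (Bcl P x)) = cmx (extra_in x *m H).
Proof.
rewrite Bcl_blocks /extra_state /extra_in mul_row_block !mulmx0 !addr0.
by rewrite /block_mx !cmx_col !col_mxKd.
Qed.

Lemma Ccl_split k x (X : 'M[R[i]]_(n + (q + q'), k)) :
  cmx (Ccl P x) *m X =
  cmx (Ccl P (core x)) *m core_state X
  + cmx (E *m extra_out x) *m extra_state X.
Proof.
rewrite /core_state /extra_state.
rewrite -(vsubmxK X); move: (usubmx X) (dsubmx X) => X1 {}X.
rewrite -(vsubmxK X); move: (usubmx X) (dsubmx X) => X2 X3.
rewrite !col_mxKd !col_mxKu /Ccl /polD /polC /core block_mxKul block_mxKur.
rewrite mul_block_col !mul0mx add0r addr0 -[in LHS](hsubmxK (ursubmx x)).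
rewrite mul_mx_row !(cmx_block, cmx_row, cmx_col) !mul_block_col mul_row_col.
rewrite mul_col_mx add_col_mx [cmx 0]map_mx0 [cmx 0]map_mx0 [cmx 0]map_mx0.
by rewrite !mul0mx !addr0 addrA.
Qed.

Lemma Dcl_core x : Dcl P (core x) = Dcl P x.
Proof. by rewrite /Dcl /polD /core block_mxKul. Qed.

Lemma core_state_scaled_sub k z (X Y : 'M[R[i]]_(n + (q + q'), k)) :
  core_state (z *: X - Y) = z *: core_state X - core_state Y.
Proof.
rewrite /core_state !linearB !linearZ /=.
by rewrite scale_col_mx opp_col_mx add_col_mx.
Qed.

Lemma extra_state_scaled_sub k z (X Y : 'M[R[i]]_(n + (q + q'), k)) :
  extra_state (z *: X - Y) = z *: extra_state X - extra_state Y.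
Proof. by rewrite /extra_state !linearB !linearZ. Qed.

(** When both couplings vanish the closed loop is decoupled, so that its
    spectrum is the union of those of [Acl P K] and [L]. *)
Lemma stabilizing_augment K L :
  stabilizing P q K -> stable L -> stabilizing P (q + q') (augment K L).
Proof.
move=> Ks Ls; apply: stable_of_unitmx => z z0.
apply: unitmx_of_right_injective => X.
rewrite mulmxBl mul_scalar_mx => zX.
have := congr1 (@core_state _) zX.
rewrite core_state_scaled_sub core_state_Acl.
have := congr1 (@extra_state _) zX.
rewrite extra_state_scaled_sub extra_state_Acl.
rewrite core_augment extra_out_augment extra_in_augment extra_dyn_augment.
rewrite mulmx0 mul0mx [cmx 0]map_mx0 [cmx 0]map_mx0 !mul0mx add0r addr0.
rewrite -!mul_scalar_mx -!mulmxBl => Z0 Y0.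
have Z : extra_state X = 0.
  rewrite -(mulKmx (stable_unitmx Ls z0) (extra_state X)) Z0.
  by rewrite /extra_state !linear0.
have Y : core_state X = 0.
  rewrite -(mulKmx (stable_unitmx Ks z0) (core_state X)) Y0.
  by rewrite /core_state !linear0 col_mx0 mulmx0.
rewrite -(vsubmxK X) -(vsubmxK (dsubmx X)) -/(extra_state X) Z.
have := congr1 usubmx Y; have := congr1 dsubmx Y.
by rewrite /core_state col_mxKu col_mxKd !linear0 => -> ->; rewrite !col_mx0.
Qed.

(** Eliminating the extra states leaves a correction which contains both
    coupling matrices as factors: a signal has to enter the extra subsystem
    and to come back. It is therefore of second order in the coupling. *)
Lemma transfer_core_diff x (w : R) (z := 0 +i* w)
    (S := invmx (z%:M - cmx (Acl P x)))
    (S1 := invmx (z%:M - cmx (Acl P (core x))))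
    (S2 := invmx (z%:M - cmx (extra_dyn x))) :
  z%:M - cmx (Acl P x) \in unitmx ->
  z%:M - cmx (Acl P (core x)) \in unitmx ->
  z%:M - cmx (extra_dyn x) \in unitmx ->
  transfer P x w - transfer P (core x) w =
  (cmx (Ccl P (core x)) *m (S1 *m cmx F) + cmx E) *m
  (cmx (extra_out x) *m (S2 *m (cmx (extra_in x) *m
    (cmx G *m core_state (S *m cmx (Bcl P x)) + cmx H)))).
Proof.
move=> u u1 u2.
set X := S *m cmx (Bcl P x); set Y := core_state X; set Z := extra_state X.
have XE : z *: X - cmx (Acl P x) *m X = cmx (Bcl P x).
  by rewrite -mul_scalar_mx -mulmxBl mulKVmx.
have := congr1 (@core_state _) XE.
have := congr1 (@extra_state _) XE.
rewrite core_state_scaled_sub core_state_Acl core_state_Bcl -/Y -/Z.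
rewrite extra_state_scaled_sub extra_state_Acl extra_state_Bcl -/Y -/Z => ZE YE.
have -> : S2 *m (cmx (extra_in x) *m (cmx G *m Y + cmx H)) = Z.
  apply: (canLR (mulKmx u2)); rewrite mulmxBl mul_scalar_mx.
  rewrite mulmxDr mulmxA -!cmxM -ZE [LHS]addrC opprD addrA.
  by rewrite [LHS]addrAC subrK.
have YY : Y - S1 *m cmx (Bcl P (core x)) =
    S1 *m (cmx F *m (cmx (extra_out x) *m Z)).
  rewrite -[X in X - _](mulKmx u1) -mulmxBr; congr (_ *m _).
  rewrite mulmxBl mul_scalar_mx -YE opprB addrA subrKA mulmxA -cmxM.
  by rewrite addrAC subrr add0r.
rewrite /transfer -/z -/S -/S1 Dcl_core opprD addrACA subrr addr0 -!mulmxA -/X.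
by rewrite Ccl_split -/Y -/Z addrAC -mulmxBr YY mulmxDl !mulmxA -cmxM.
Qed.

(** The other factors of the correction are bounded uniformly in the frequency
    and in the policy, by the resolvent bounds around the three stable matrices
    [Acl P (augment K L)], [Acl P K] and [L]. *)
Lemma transfer_core_gap K L : stabilizing P q K -> stable L ->
  exists c d : R, [/\ 0 <= c, 0 < d & forall x (w : R),
    sumnorm (cmx (x - augment K L)) <= d ->
    sumnorm (transfer P x w - transfer P (core x) w) <=
    c * (sumnorm (cmx (extra_out x)) * sumnorm (cmx (extra_in x)))].
Proof.
move=> Ks Ls.
have [c [d [c0 d0 cP]]] :=
  closed_loop_resolvent_near (stabilizing_augment Ks Ls).
have [c1 [d1 [c10 d10 c1P]]] := closed_loop_resolvent_near Ks.
have [c3 [d3 [c30 d30 c3P]]] := stable_resolvent_near Ls.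
pose f := sumnorm (cmx (actuation P q)); pose g := sumnorm (cmx (sensing P q)).
pose h := sumnorm (cmx (sensor_noise P q)).
pose e := sumnorm (cmx (control_cost P q)).
pose kC := sumnorm (cmx (Ccl P K)) + e * g.
pose kB := sumnorm (cmx (Bcl P (augment K L))) +
  sumnorm (cmx (actuation P (q + q'))) *
  sumnorm (cmx (sensor_noise P (q + q'))).
exists ((kC * (c1 * f) + e) * c3 * (g * (c * kB) + h)).
exists (Num.min (Num.min d d1) (Num.min d3 1)).
have [f0 g0 h0 e0] : [/\ 0 <= f, 0 <= g, 0 <= h & 0 <= e].
  by split; exact: sumnorm_ge0.
have kC0 : 0 <= kC by rewrite addr_ge0 ?mulr_ge0 ?sumnorm_ge0.
have kB0 : 0 <= kB by rewrite addr_ge0 ?mulr_ge0 ?sumnorm_ge0.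
have l0 : 0 <= kC * (c1 * f) + e by rewrite addr_ge0 // mulr_ge0 // mulr_ge0.
have r0 : 0 <= g * (c * kB) + h by rewrite addr_ge0 // mulr_ge0 // mulr_ge0.
split; first by rewrite mulr_ge0 // mulr_ge0.
  by rewrite !lt_min d0 d10 d30 ltr01.
move=> x w; rewrite !le_min => /andP[/andP[xd xd1] /andP[xd3 x1]].
have coreE : core x - K = core (x - augment K L).
  by rewrite -[in RHS]scaleN1r core_line core_augment scaleN1r.
have dynE : extra_dyn x - L = extra_dyn (x - augment K L).
  by rewrite -[in RHS]scaleN1r extra_dyn_line extra_dyn_augment scaleN1r.
have [u uc] := cP x w xd.
have xd1' : sumnorm (cmx (core x - K)) <= d1.
  by rewrite coreE; exact: le_trans (sumnorm_core _) xd1.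
have xd3' : sumnorm (cmx (extra_dyn x - L)) <= d3.
  by rewrite dynE; exact: le_trans (sumnorm_extra_dyn _) xd3.
have [u1 u1c] := c1P (core x) w xd1'.
have [u3 u3c] := c3P (extra_dyn x) (0 +i* w) xd3' (lexx _).
rewrite transfer_core_diff //.
have -> : forall u v : R,
    (kC * (c1 * f) + e) * c3 * (g * (c * kB) + h) * (u * v) =
    (kC * (c1 * f) + e) * (u * (c3 * (v * (g * (c * kB) + h)))).
  by move=> *; ring.
have Cc : sumnorm (cmx (Ccl P (core x))) <= kC.
  rewrite /kC !CclE; apply: affine_bounded_near; rewrite coreE.
  exact: le_trans (sumnorm_core _) x1.
have Bc : sumnorm (cmx (Bcl P x)) <= kB.
  by rewrite /kB !BclE; apply: affine_bounded_near.
apply: sumnorm_mul_le.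
  apply: le_trans (sumnormD _ _) _; rewrite lerD2r.
  by do 2!(apply: sumnorm_mul_le => //).
do 3!(apply: sumnorm_mul_le => //).
apply: le_trans (sumnormD _ _) _; rewrite lerD2r.
apply: sumnorm_mul_le => //; apply: le_trans (sumnorm_core_state _) _.
exact: sumnorm_mul_le.
Qed.

(** When the two functions are unbounded, both [sup] are 0 by convention and
    the inequality follows from [0 <= b]. *)
Lemma sup_range_gap (f g : R -> R) (b : R) :
  (forall w, f w <= g w + b) -> (forall w, g w <= f w + b) ->
  sup (range f) <= sup (range g) + b.
Proof.
move=> fg gf; have [|ngub] := pselect (has_ubound (range g)).
  move=> gub; apply: ge_sup; first by exists (f 0); exists 0.
  move=> _ [w _ <-]; apply: le_trans (fg w) _; rewrite lerD2r.
  by apply: ub_le_sup => //; exists w.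
rewrite !sup_out; first by have := fg 0; have := gf 0; rewrite add0r; lra.
  by case.
case=> _ [y fy]; apply: ngub; exists (y + b) => _ [w _ <-].
by apply: le_trans (gf w) _; rewrite lerD2r; apply: fy; exists w.
Qed.

Lemma Jinf_core_gap x b : (0 < n)%N ->
  (forall w, sumnorm (transfer P x w - transfer P (core x) w) <= b) ->
  `|Jinf P (q + q') x - Jinf P q (core x)| <= b.
Proof.
move=> n0 xb; have np : (0 < n + p)%N by rewrite addn_gt0 n0.
have h1 w : sigma_max (transfer P x w) <= sigma_max (transfer P (core x) w) + b.
  apply: le_trans (sigma_max_lipschitz _ (transfer P (core x) w) np) _.
  by rewrite lerD2l.
have h2 w : sigma_max (transfer P (core x) w) <= sigma_max (transfer P x w) + b.
  apply: le_trans (sigma_max_lipschitz _ (transfer P x w) np) _.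
  by rewrite lerD2l -sumnormN opprB.
have le1 : Jinf P (q + q') x <= Jinf P q (core x) + b := sup_range_gap h1 h2.
have le2 : Jinf P q (core x) <= Jinf P (q + q') x + b := sup_range_gap h2 h1.
(* Generalizing the two costs keeps unification from comparing their
   unfoldings. *)
move: (Jinf P (q + q') x) (Jinf P q (core x)) le1 le2 => J J' le1 le2.
by rewrite ler_distl lerBlDr le2.
Qed.

End Split.

(** * Transport of Clarke stationarity *)

Section Stationarity.
Variable R : realType.

Lemma near_sumnorm_le a b (M : 'M[R]_(a, b)) (d : R) : 0 < d ->
  \forall N \near M, sumnorm (cmx (N - M)) <= d.
Proof.
move=> d0; apply/nbhs_ballP.
have ab0 : (0 : R) < (a * b).+1%:R by rewrite ltr0n.
exists (d / (a * b).+1%:R) => /=; first by rewrite divr_gt0.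
move=> N [_ MN].
apply: (@le_trans _ _ (\sum_(i < a) \sum_(j < b) d / (a * b).+1%:R)).
  do 2!apply: ler_sum => ? _.
  by rewrite !mxE /= expr0n addr0 sqrtr_sqr distrC; apply: ltW; exact: MN.
rewrite !sumr_const !card_ord -mulrnA mulnC -[leLHS]mulr_natr mulrAC.
by rewrite ler_pdivrMr // ler_wpM2l ?ler_nat ?leqnSn // ltW.
Qed.

Lemma augment_continuous m p q q' (L : 'M[R]_q') :
  continuous (fun K : 'M[R]_(m + q, p + q) => augment K L).
Proof.
move=> K A /nbhs_ballP[e e0 eA]; apply/nbhs_ballP; exists e => // K' [_ KK'].
apply: eA; split=> // i j; rewrite /augment /polD /polC /polB /polA.
rewrite !mxE; case: (fintype.split i) => i'; rewrite !mxE;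
  case: (fintype.split j) => j'; rewrite !mxE.
- exact: KK'.
- by case: (fintype.split j') => j''; rewrite !mxE;
    [exact: KK'|exact: ballxx].
- by case: (fintype.split i') => i''; rewrite !mxE;
    [exact: KK'|exact: ballxx].
case: (fintype.split i') => i''; rewrite !mxE;
  case: (fintype.split j') => j''; rewrite ?mxE;
  by [exact: KK'|exact: ballxx].
Qed.

End Stationarity.

(** The limit superior defining the directional derivative of [f] may be tested
    on base points of the form [iota y] only. There a difference quotient of
    [f] in the direction [v] is at least one of [g] in the direction [v'],
    minus [c * t], which tends to 0. *)
Lemma clarke_zero_transport (R : realType) (a b a' b' : nat)
    (g : 'M[R]_(a, b) -> R) (f : 'M[R]_(a', b') -> R)
    (iota : 'M[R]_(a, b) -> 'M[R]_(a', b')) (x : 'M[R]_(a, b)) :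
  {for x, continuous iota} ->
  (\forall y \near x, f (iota y) = g y) ->
  (forall v, exists v' (c : R), (filter_prod (nbhs x) (0 : R)^'+)
     [set yt | g (yt.1 + yt.2 *: v') - c * yt.2 ^+ 2 <=
               f (iota yt.1 + yt.2 *: v)]) ->
  clarke_subdiff g x 0 -> clarke_subdiff f (iota x) 0.
Proof.
move=> iotax fg dirs gx v.
have [v' [c [[U0 T0] [/= U0x T00] U0T0]]] := dirs v.
rewrite /trace_dot trmx0 mul0mx mxtrace0 /clarke_dd limf_esupE.
apply: le_ereal_inf_tmp => _ [A [[U T] [/= Ux T0'] UTA] <-].
apply/lee_addgt0Pr => e e0.
pose V := [set y | [/\ U (iota y), U0 y & f (iota y) = g y]].
pose S := [set t : R | [/\ T t, T0 t, 0 < t & `|c| * t <= e / 2]].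
have VS : filter_prod (nbhs x) (0 : R)^'+ (V `*` S).
  exists (V, S) => //; split => /=.
    near=> y; split; [|by near: y|by near: y].
    by near: y; exact: iotax.
  near=> t; split; [by near: t|by near: t|by near: t; exact: nbhs_right_gt|].
  have tb : t <= e / 2 / (`|c| + 1).
    by near: t; apply: nbhs_right_le; rewrite divr_gt0 // ?divr_gt0 // ltr_wpDl.
  rewrite ler_pdivlMr ?ltr_wpDl // in tb; apply: le_trans tb.
  by rewrite mulrC ler_wpM2l // lerDl.
have := gx v'.
rewrite /trace_dot trmx0 mul0mx mxtrace0 /clarke_dd limf_esupE => gv.
have {gv} : (0 <= ereal_sup ((fun yt : 'M[R]_(a, b) * R =>
    ((g (yt.1 + yt.2 *: v') - g yt.1) / yt.2)%:E) @` (V `*` S)))%E.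
  by apply: le_trans gv _; apply: ereal_inf_lbound; exists (V `*` S).
have e2 : ((- (e / 2))%:E < 0)%E by rewrite lte_fin oppr_lt0 divr_gt0.
move=> /(lt_le_trans e2)/ereal_sup_gt[_ [[y t] /= [[Uy U0y fgy] S_t] <-]].
have [Tt T0t t0 tc] := S_t.
rewrite lte_fin => quot.
have gf : g (y + t *: v') - c * t ^+ 2 <= f (iota y + t *: v).
  exact: (U0T0 (y, t)).
apply: (@le_trans _ _ (((f (iota y + t *: v) - f (iota y)) / t)%:E + e%:E)%E);
    last first.
  rewrite leeD2r //; apply: ereal_sup_ubound; exists (iota y, t) => //.
  exact: UTA.
rewrite -EFinD lee_fin fgy -[X in _ + X](mulfK (lt0r_neq0 t0)) -mulrDl.
rewrite divr_ge0 ?(ltW t0) //.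
rewrite ltr_pdivlMr // in quot.
have ct : c * t ^+ 2 <= e / 2 * t.
  rewrite expr2 mulrA ler_wpM2r ?(ltW t0) //; apply: le_trans tc.
  by rewrite ler_wpM2r ?(ltW t0) // ler_norm.
move: (f _) (g _) (g _) (c * _) quot gf ct => F G G' ct quot gf ctle; lra.
Unshelve. all: by end_near.
Qed.

Theorem theorem5p3 (R : realType) (n m p : nat) (P : plant R n m p)
    (hn : (0 < n)%N) (hm : (0 < m)%N) (hp : (0 < p)%N)
    (hQ : psdmx (plQ P)) (hW : psdmx (plW P))
    (hR : pdmx (plR P)) (hV : pdmx (plV P))
    (hAB : controllable (plA P) (plB P))
    (hAW : controllable (plA P) (sqrtmx (plW P)))
    (hCA : observable (plC P) (plA P))
    (hQA : observable (sqrtmx (plQ P)) (plA P))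
    (q : nat) (K : 'M[R]_(m + q, p + q)) :
  stabilizing P q K ->
  clarke_subdiff (Jinf P q) K 0 ->
  forall (q' : nat) (L : 'M[R]_q'), (0 < q')%N -> stable L ->
    [/\ stabilizing P (q + q') (augment K L),
        clarke_subdiff (Jinf P (q + q')) (augment K L) 0 &
        Jinf P (q + q') (augment K L) = Jinf P q K].
Proof.
move=> Ks Kcrit q' L _ Ls.
have [c [d [c0 d0 gap]]] := transfer_core_gap Ks Ls.
have d2 : 0 < d / 2 by rewrite divr_gt0.
have J_augment K' : sumnorm (cmx (augment K' L - augment K L)) <= d ->
    Jinf P (q + q') (augment K' L) = Jinf P q K'.
  move=> K'd.
  have : `|Jinf P (q + q') (augment K' L) -
           Jinf P q (core (augment K' L))| <= 0.
    apply: Jinf_core_gap => // w; apply: le_trans (gap _ w K'd) _.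
    by rewrite extra_out_augment [cmx _]map_mx0 sumnorm0 mul0r mulr0.
  by rewrite core_augment normr_le0 subr_eq0 => /eqP.
have near_augment (r : R) : 0 < r ->
    \forall K' \near K, sumnorm (cmx (augment K' L - augment K L)) <= r.
  move=> r0.
  have := @near_sumnorm_le _ _ _ (augment K L) r r0.
  exact: (@augment_continuous R m p q q' L K).
split; first exact: stabilizing_augment.
  apply: (clarke_zero_transport (g := Jinf P q)
            (iota := fun K' => augment K' L)) Kcrit.
  - exact: augment_continuous.
  - by near=> K'; apply: J_augment; near: K'; exact: near_augment.
  move=> v; exists (core v).
  exists (c * (sumnorm (cmx (extra_out v)) * sumnorm (cmx (extra_in v)))).
  pose S := [set t : R | 0 < t /\ t * sumnorm (cmx v) <= d / 2].
  exists ([set K' | sumnorm (cmx (augment K' L - augment K L)) <= d / 2], S).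
    split => /=; first exact: near_augment.
    near=> t; split; first by near: t; exact: nbhs_right_gt.
    have ts : t <= d / 2 / (sumnorm (cmx v) + 1).
      near: t; apply: nbhs_right_le.
      by rewrite divr_gt0 // ltr_wpDl ?sumnorm_ge0.
    rewrite ler_pdivlMr ?ltr_wpDl ?sumnorm_ge0 // in ts; apply: le_trans ts.
    by rewrite ler_wpM2l // lerDl.
  move=> [K' t] /= [K'd [t0 ts]].
  have cmxZ a b (M : 'M[R]_(a, b)) :
      sumnorm (cmx (t *: M)) = t * sumnorm (cmx M).
    by rewrite /cmx map_mxZ sumnormZ /= expr0n addr0 sqrtr_sqr gtr0_norm.
  have xd : sumnorm (cmx (augment K' L + t *: v - augment K L)) <= d.
    rewrite addrAC cmxD [d]splitr.
    by apply: le_trans (sumnormD _ _) (lerD K'd _); rewrite cmxZ.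
  rewrite lerBlDr -lerBlDl; apply: le_trans (ler_norm _) _; rewrite distrC.
  have -> : K' + t *: core v = core (augment K' L + t *: v).
    by rewrite core_line core_augment.
  apply: Jinf_core_gap => // w; apply: le_trans (gap _ w xd) _.
  rewrite extra_out_line extra_in_line extra_out_augment extra_in_augment.
  rewrite !add0r.
  rewrite !cmxZ le_eqVlt; apply/orP; left; apply/eqP.
  move: (sumnorm _) (sumnorm _) => u u'.
  ring.
by apply: J_augment; rewrite subrr [cmx _]map_mx0 sumnorm0 ltW.
Unshelve. all: by end_near.
Qed.
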